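(* Every formula is concise in every (infinite) torsion group. In particular, every formula is concise in any Burnside group $\mathrm B(d,n)$, where $d,n$ are positive integers.
   Context: A formula is a first-order formula $\varphi(x)$ in the language of groups $\{1,\cdot,{}^{-1}\}$ with one free variable $x$ and without parameters. For a group $G$, $G_\varphi:=\{g\in G\mid\varphi(g)\text{ is true in }G\}$ and $\varphi(G):=\langle G_\varphi\rangle$. A formula $\varphi$ is concise in $G$ if finiteness of $G_\varphi$ implies finiteness of $\varphi(G)$. A torsion group is a group all of whose elements have finite order. For positive integers $d,n$, the Burnside group $\mathrm B(d,n)$ is the quotient of the free group on $d$ generators by the normal subgroup generated by all $n$th powers. *)

(* Defs.v *)
From HB Require Import structures.
From mathcomp Require Import all_boot.
From mathcomp Require Import boolp classical_sets cardinality.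

Set Implicit Arguments.
Unset Strict Implicit.
Unset Printing Implicit Defensive.

Local Open Scope classical_set_scope.
Local Open Scope group_scope.

(* Terms and formulas are well scoped: the index [k] bounds the free
   variables, which are de Bruijn indices in ['I_k].  A quantifier binds the
   variable [ord0] of its body and shifts the other ones by [lift ord0]. *)
Inductive term (k : nat) : Type :=
| Var of 'I_k
| One
| Mul of term k & term k
| Inv of term k.

Inductive formula : nat -> Type :=
| Eq k of term k & term k : formula k
| Bot k : formula k
| And k of formula k & formula k : formula k
| Or k of formula k & formula k : formula k
| Imp k of formula k & formula k : formula k
| Not k of formula k : formula k
| All k of formula k.+1 : formula k
| Ex k of formula k.+1 : formula k.

Arguments One {k}.
Arguments Bot {k}.

Section Semantics.
Variable G : groupType.

Fixpoint eval k (e : 'I_k -> G) (t : term k) : G :=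
  match t with
  | Var i => e i
  | One => 1
  | Mul t u => eval e t * eval e u
  | Inv t => (eval e t)^-1
  end.

Definition extend k (g : G) (e : 'I_k -> G) : 'I_k.+1 -> G :=
  fun i => if unlift ord0 i is Some j then e j else g.

Fixpoint holds k (phi : formula k) : ('I_k -> G) -> Prop :=
  match phi with
  | Eq _ t u => fun e => eval e t = eval e u
  | Bot _ => fun=> False
  | And _ p q => fun e => holds p e /\ holds q e
  | Or _ p q => fun e => holds p e \/ holds q e
  | Imp _ p q => fun e => holds p e -> holds q e
  | Not _ p => fun e => ~ holds p e
  | All _ p => fun e => forall g, holds p (extend g e)
  | Ex _ p => fun e => exists g, holds p (extend g e)
  end.

End Semantics.

Section Subgroups.
Variable G : groupType.

Definition is_subgroup (H : set G) : Prop :=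
  [/\ H 1, forall x y, H x -> H y -> H (x * y) & forall x, H x -> H x^-1].

Definition is_normal_subgroup (N : set G) : Prop :=
  is_subgroup N /\ forall x g, N x -> N (x ^ g).

Definition generated (A : set G) : set G := smallest is_subgroup A.

Definition definable_set (phi : formula 1) : set G :=
  [set g | holds phi (fun=> g)].

Definition formula_subgroup (phi : formula 1) : set G :=
  generated (definable_set phi).

Definition concise (phi : formula 1) : Prop :=
  finite_set (definable_set phi) -> finite_set (formula_subgroup phi).

Definition torsion_group : Prop :=
  forall x : G, exists2 m, (0 < m)%N & x ^+ m = 1.

End Subgroups.

Arguments concise G phi : clear implicits.
Arguments torsion_group G : clear implicits.

Record normalSubgroup (G : groupType) := NormalSubgroup {
  nsg_set :> G -> Prop;
  nsgP : is_normal_subgroup nsg_set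
}.

Section Quotient.
Variables (G : groupType) (N : normalSubgroup G).

Definition coset_rel (x y : G) : bool := `[< N (x^-1 * y) >].

Lemma coset_relP : equiv_class_of coset_rel.
Proof.
have [[N1 NM NV] _] := nsgP N; split => [x|x y|y x z].
- by apply/asboolP; rewrite mulVg.
- by apply/asboolP/asboolP => /NV; rewrite invgM invgK.
- by move=> /asboolP xy /asboolP yz; apply/asboolP;
    have := NM _ _ xy yz; rewrite -mulgA mulVKg.
Qed.

Canonical coset_equiv := EquivRelPack coset_relP.

Definition quotient_group := {eq_quot coset_equiv}%qT.
HB.instance Definition _ := Choice.on quotient_group.

Definition proj (x : G) : quotient_group := (\pi_quotient_group x)%qT.

Lemma proj_eq x y : proj x = proj y <-> N (x^-1 * y).
Proof.
split => [/eqquotP/asboolP//|Nxy].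
by apply/eqquotP/asboolP.
Qed.

Lemma proj_surj (u : quotient_group) : exists x, proj x = u.
Proof. by exists (repr u); rewrite /proj reprK. Qed.

Definition quo_one : quotient_group := proj 1.
Definition quo_mul (u v : quotient_group) := proj (repr u * repr v).
Definition quo_inv (u : quotient_group) := proj (repr u)^-1.

Lemma proj_repr x : N (x^-1 * repr (proj x)).
Proof. by apply/proj_eq; rewrite /proj reprK. Qed.

Lemma quo_mulE x y : quo_mul (proj x) (proj y) = proj (x * y).
Proof.
have [[_ NM NV] NJ] := nsgP N; apply/esym/proj_eq.
have := NM _ _ (NJ _ y (proj_repr x)) (proj_repr y).
by rewrite /conjg invgM !mulgA mulgK.
Qed.

Lemma quo_invE x : quo_inv (proj x) = proj x^-1.
Proof.
have [[_ _ NV] NJ] := nsgP N; apply/esym/proj_eq.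
have := NJ _ x^-1 (NV _ (proj_repr x)).
by rewrite /conjg !invgM !invgK mulgK.
Qed.

Lemma quo_mulA : associative quo_mul.
Proof.
move=> u v w; have [x <-] := proj_surj u; have [y <-] := proj_surj v.
by have [z <-] := proj_surj w; rewrite !quo_mulE mulgA.
Qed.

Lemma quo_mul1g : left_id quo_one quo_mul.
Proof. by move=> u; have [x <-] := proj_surj u; rewrite quo_mulE mul1g. Qed.

Lemma quo_mulg1 : right_id quo_one quo_mul.
Proof. by move=> u; have [x <-] := proj_surj u; rewrite quo_mulE mulg1. Qed.

Lemma quo_mulVg : left_inverse quo_one quo_inv quo_mul.
Proof.
by move=> u; have [x <-] := proj_surj u; rewrite quo_invE quo_mulE mulVg.
Qed.

Lemma quo_mulgV : right_inverse quo_one quo_inv quo_mul.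
Proof.
by move=> u; have [x <-] := proj_surj u; rewrite quo_invE quo_mulE mulgV.
Qed.

HB.instance Definition _ := isGroup.Build quotient_group
  quo_mulA quo_mul1g quo_mulg1 quo_mulVg quo_mulgV.

Lemma projM : {morph proj : x y / x * y}.
Proof. by move=> x y; rewrite -quo_mulE. Qed.

Lemma proj1 : proj 1 = 1. Proof. by []. Qed.

End Quotient.

Section NormalClosure.
Variables (G : groupType) (A : set G).

Lemma normal_closure_subproof :
  is_normal_subgroup (smallest (@is_normal_subgroup G) A).
Proof.
split; first split.
- by move=> H [[[]]].
- by move=> x y Hx Hy H HA; have := (Hx H HA, Hy H HA);
    case: HA => [[[_ HM _] _] _] [? ?]; exact: HM.
- by move=> x Hx H HA; have := Hx H HA; case: HA => [[[_ _ HV] _] _]; exact: HV.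
- by move=> x g Hx H HA; have := Hx H HA; case: HA => [[_ HJ] _]; exact: HJ.
Qed.

Definition normal_closure := NormalSubgroup normal_closure_subproof.

End NormalClosure.

Section FreeGroup.
Variable X : choiceType.

(* The letter [(x, false)] stands for the generator [x], and [(x, true)] for
   its inverse. *)
Local Notation letter := (X * bool)%type.
Implicit Types (a b : letter) (u v w : seq letter).

Definition invl a : letter := (a.1, ~~ a.2).

Definition reduced w : bool := sorted (fun a b => b != invl a) w.

Definition free_group := {w : seq letter | reduced w}.
HB.instance Definition _ := SubChoice.on free_group.

(* Left multiplication of a reduced word by a letter. *)
Definition push a w :=
  if w is b :: w' then if b == invl a then w' else a :: w else [:: a].

Lemma invlK : involutive invl.
Proof. by case=> x b; rewrite /invl /= negbK. Qed.

Lemma push_reduced a w : reduced w -> reduced (push a w).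
Proof.
case: w => // b w rw /=; case: ifPn => [_|ab]; last by rewrite /= ab.
by move: rw; apply: path_sorted.
Qed.

Lemma pushK a w : reduced w -> push (invl a) (push a w) = w.
Proof.
case: w => [|b w] rw /=; first by rewrite invlK eqxx.
case: (eqVneq b (invl a)) => [ba|_]; last by rewrite /= invlK eqxx.
by case: w rw => [|c w] /=; rewrite -ba // => /andP[/negPf->].
Qed.

Lemma pushVK a w : reduced w -> push a (push (invl a) w) = w.
Proof. by move=> /(pushK (invl a)); rewrite invlK. Qed.

Lemma foldr_reduced w u : reduced w -> reduced (foldr push w u).
Proof. by move=> rw; elim: u => //= a u; apply: push_reduced. Qed.

Lemma foldr_push a w v : reduced w ->
  foldr push w (push a v) = push a (foldr push w v).
Proof.
case: v => //= b v rw; case: eqP => //= ->.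
by rewrite pushVK // foldr_reduced.
Qed.

Lemma foldr_nil w : reduced w -> foldr push [::] w = w.
Proof.
elim: w => //= a w IHw rw; rewrite (IHw (path_sorted rw)).
by case: w rw {IHw} => //= b w /andP[/negPf->].
Qed.

Definition inv_word w := rev (map invl w).

Lemma inv_word_reduced w : reduced w -> reduced (inv_word w).
Proof.
rewrite /reduced /inv_word rev_sorted sorted_map; apply: sub_sorted => a b /=.
by rewrite invlK; apply: contraNneq => ->.
Qed.

Definition free_one : free_group := exist _ [::] isT.
Definition free_mul (u v : free_group) : free_group :=
  exist _ (foldr push (val v) (val u)) (foldr_reduced (val u) (valP v)).
Definition free_inv (u : free_group) : free_group :=
  exist _ (inv_word (val u)) (inv_word_reduced (valP u)).

Lemma free_mulA : associative free_mul.
Proof.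
move=> [u ru] [v rv] [w rw]; apply/val_inj => /= {ru rv}.
by elim: u => //= a u ->; rewrite foldr_push.
Qed.

Lemma free_mul1g : left_id free_one free_mul.
Proof. by move=> u; apply/val_inj. Qed.

Lemma free_mulg1 : right_id free_one free_mul.
Proof. by move=> [u ru]; apply/val_inj => /=; rewrite foldr_nil. Qed.

Lemma free_mulVg : left_inverse free_one free_inv free_mul.
Proof.
move=> [u ru]; apply/val_inj => /=; rewrite /inv_word.
elim: u ru => //= a u IHu ru; have ru' := path_sorted ru.
rewrite rev_cons foldr_rcons -[RHS](IHu ru'); congr foldr.
by rewrite /= invlK eqxx.
Qed.

Lemma free_invK : involutive free_inv.
Proof.
move=> [u ru]; apply/val_inj => /=; rewrite /inv_word map_rev revK -map_comp.
by rewrite (eq_map invlK) map_id.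
Qed.

Lemma free_mulgV : right_inverse free_one free_inv free_mul.
Proof. by move=> u; rewrite -{1}[u]free_invK free_mulVg. Qed.

HB.instance Definition _ := isGroup.Build free_group
  free_mulA free_mul1g free_mulg1 free_mulVg free_mulgV.

End FreeGroup.

Definition powers (G : groupType) (n : nat) : set G := range (fun x => x ^+ n).

Definition burnside_group (d n : nat) : groupType :=
  quotient_group (normal_closure (@powers (free_group 'I_d) n)).

(* Main.v *)
Require Import Defs.
From mathcomp Require Import all_boot.
From mathcomp Require Import boolp classical_sets cardinality.

(* A set defined by a formula without parameters is preserved by every
   automorphism, in particular by conjugation, so the theorem follows from
   Dietzmann's lemma: a finite set [A] of elements of finite order that is
   stable under conjugation generates a finite subgroup.  Indeed, if [m] is a
   common exponent of the elements of [A], in a long enough word over [A] some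
   letter occurs at least [m] times by the pigeonhole principle; [m] of these
   occurrences can be moved to the front, conjugating the letters they cross,
   and cancel out.  Hence the words of length at most [#|A| * m] already
   represent all the products of elements of [A]. *)

Set Implicit Arguments.
Unset Strict Implicit.
Unset Printing Implicit Defensive.

Section FormulaIsomorphism.
Local Open Scope group_scope.
Variables (G H : groupType) (f : G -> H).
Hypotheses (fM : {morph f : x y / x * y}) (f_bij : bijective f).

Lemma morph_one : f 1 = 1.
Proof. by apply: (@mulgI _ (f 1)); rewrite -fM !mulg1. Qed.

Lemma morph_inv : {morph f : x / x^-1}.
Proof.
by move=> x; apply/esym/mulg1_eq; rewrite -fM mulgV morph_one.
Qed.

Lemma eval_morph k (e : 'I_k -> G) (t : term k) :
  eval (f \o e) t = f (eval e t).
Proof.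
elim: t => [i||t IHt u IHu|t IHt] //=; first by rewrite morph_one.
  by rewrite IHt IHu fM.
by rewrite IHt morph_inv.
Qed.

Lemma extend_comp k (g : G) (e : 'I_k -> G) :
  extend (f g) (f \o e) = f \o extend g e.
Proof. by apply/funext => i; rewrite /extend /=; case: unlift. Qed.

(** Injectivity of [f] reflects equations, and surjectivity lets a quantifier over [H] range over
    the values of [f]. *)
Lemma holds_iso k (phi : formula k) (e : 'I_k -> G) :
  holds phi (f \o e) <-> holds phi e.
Proof.
have [f' fK f'K] := f_bij.
elim: phi e => {k} [k t u|k|k p IHp q IHq|k p IHp q IHq|k p IHp q IHq|k p IHp
  |k p IHp|k p IHp] e //=.
- by rewrite !eval_morph; split => [/(can_inj fK)|->].
- by rewrite IHp IHq.
- by rewrite IHp IHq.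
- by rewrite IHp IHq.
- by rewrite IHp.
- split => pe g; first by apply/IHp; rewrite -extend_comp.
  by rewrite -[g]f'K extend_comp; apply/IHp.
- split => -[g pg]; last by exists (f g); rewrite extend_comp; apply/IHp.
  by exists (f' g); apply/IHp; rewrite -extend_comp f'K.
Qed.

End FormulaIsomorphism.

Lemma definable_setJ (G : groupType) (phi : formula 1) (x g : G) :
  definable_set phi x -> definable_set phi (x ^ g)%g.
Proof.
have JM : {morph (fun y : G => (y ^ g)%g) : y z / (y * z)%g}.
  by move=> y z; exact: conjMg.
have J_bij : bijective (fun y : G => (y ^ g)%g).
  by exists (fun y => (y ^ g^-1)%g) => y; rewrite ?conjgK ?conjgKV.
(* Composing conjugation with the constant assignment [x] is convertible to the constant assignment
   [x ^ g]. *)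
exact: (proj2 (holds_iso JM J_bij phi (fun=> x))).
Qed.

Section Dietzmann.
Local Open Scope group_scope.
Variable G : groupType.
Implicit Types (x : G) (s w : seq G).

Lemma common_exponent s :
    (forall x, x \in s -> exists2 m, (0 < m)%N & x ^+ m = 1) ->
  exists2 m, (0 < m)%N & forall x, x \in s -> x ^+ m = 1.
Proof.
elim: s => [|y s IHs] tor_s; first by exists 1%N.
have [|m m_gt0 sm] := IHs.
  by move=> x xs; apply: tor_s; rewrite inE xs orbT.
have [n n_gt0 yn] := tor_s y (mem_head _ _).
exists (n * m)%N; first by rewrite muln_gt0 n_gt0.
move=> x; rewrite inE => /predU1P[->|/sm xm]; first by rewrite expgnA yn expg1n.
by rewrite mulnC expgnA xm expg1n.
Qed.

Lemma pigeonhole_count (T : eqType) (s w : seq T) m : {subset w <= s} ->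
  (size s * m < size w)%N -> exists2 x, x \in s & (m <= count_mem x w)%N.
Proof.
elim: s w => [|y s IHs] w sws.
  by case: w sws => // a w /(_ a (mem_head _ _)).
rewrite mulSn => w_gt.
have [mw|mw] := leqP m (count_mem y w); first by exists y; rewrite ?mem_head.
(* As [y] occurs fewer than [m] times, deleting it leaves more than [size s * m] letters, all in the
   tail of the alphabet. *)
have [z||x xs xw] := IHs [seq z <- w | z != y].
- by rewrite mem_filter => /andP[zy /sws]; rewrite inE (negPf zy).
- rewrite size_filter -(ltn_add2l (count_mem y w)) (count_predC (pred1 y)).
  by apply: leq_ltn_trans w_gt; rewrite leq_add2r ltnW.
- exists x; first by rewrite inE xs orbT.
  apply: leq_trans xw _; rewrite count_filter.
  by apply: sub_count => z /andP[].
Qed.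

(** Copies of [x] move left by [a * x ^+ k = x ^+ k * a ^ (x ^+ k)]: the crossed letter is
    conjugated but stays in [s], and the length is unchanged. *)
Lemma pull_letter s w x k :
    (forall y g, y \in s -> g \in s -> y ^ g \in s) ->
    x \in s -> {subset w <= s} -> (k <= count_mem x w)%N ->
  exists v, [/\ {subset v <= s}, size w = (k + size v)%N
    & \prod_(y <- w) y = x ^+ k * \prod_(y <- v) y].
Proof.
move=> sJ xs.
(* [sJ] only conjugates by letters, so a power of [x] is handled one factor at a time. *)
have sJX y n : y \in s -> y ^ (x ^+ n) \in s.
  move=> ys; elim: n => [|n IHn]; first by rewrite conjg1.
  by rewrite expgSr conjgM sJ.
elim: w k => [|a w IHw] [|k] //= sws.
- by move=> _; exists [::]; rewrite mul1g.
- by move=> _; exists (a :: w); rewrite mul1g.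
have sw : {subset w <= s} by move=> y yw; apply: sws; rewrite inE yw orbT.
(* A head equal to [x] is itself one of the [k.+1] copies; otherwise all of them come from the tail
   and cross [a]. *)
have [->|_] := eqVneq a x => [kw|kw].
  have [v [vs -> wv]] := IHw k sw kw.
  by exists v; rewrite big_cons wv mulgA -expgS addSn.
have [v [vs -> wv]] := IHw k.+1 sw kw.
exists (a ^ (x ^+ k.+1) :: v); split; last 2 first.
- by rewrite /= addnS.
- by rewrite !big_cons wv mulgA (conjgC a) -mulgA.
move=> y; rewrite inE => /predU1P[->|/vs//].
by rewrite sJX // sws ?mem_head.
Qed.

Lemma short_word s m w :
    (0 < m)%N -> (forall x, x \in s -> x ^+ m = 1) ->
    (forall x g, x \in s -> g \in s -> x ^ g \in s) -> {subset w <= s} ->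
  exists v, [/\ {subset v <= s}, (size v <= size s * m)%N
    & \prod_(y <- v) y = \prod_(y <- w) y].
Proof.
move=> m_gt0 sm sJ.
have [n] := ubnP (size w); elim: n => // n IHn in w * => w_lt sws.
have [w_le|w_gt] := leqP (size w) (size s * m); first by exists w.
have [x xs xw] := pigeonhole_count sws w_gt.
have [u [us sz_w ->]] := pull_letter sJ xs sws xw.
have [|v [vs v_le <-]] := IHn u _ us; last by exists v; rewrite sm // mul1g.
(* Cancelling [x ^+ m] strictly shortens the word because [m] is positive. *)
rewrite -ltnS; apply: leq_trans w_lt; rewrite ltnS sz_w.
by rewrite -add1n leq_add2r.
Qed.

Fixpoint products s n : seq G :=
  if n is n'.+1 then
    products s n' ++ [seq x * y | x <- s, y <- products s n']
  else [:: 1].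

Lemma mem_products s n w : {subset w <= s} -> (size w <= n)%N ->
  \prod_(y <- w) y \in products s n.
Proof.
elim: n w => [|n IHn] [|a w] //= sws w_le; rewrite ?big_nil ?inE //.
  by have := IHn [::] sws isT; rewrite big_nil mem_cat => ->.
have sw : {subset w <= s} by move=> y yw; apply: sws; rewrite inE yw orbT.
rewrite mem_cat big_cons; apply/orP; right; apply: allpairs_f.
  exact/sws/mem_head.
exact: IHn.
Qed.

(** Words need no inverse letters: [a ^+ m = 1] gives [a^-1 = a ^+ m.-1], so the products of words
    already form a subgroup. *)
Lemma generated_word s m : (0 < m)%N -> (forall x, x \in s -> x ^+ m = 1) ->
  forall x, generated [set` s] x ->
  exists2 w, {subset w <= s} & x = \prod_(y <- w) y.
Proof.
move=> m_gt0 sm; apply: smallest_sub => [|x xs]; last first.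
  by exists [:: x]; rewrite ?big_seq1 // => y; rewrite inE => /eqP->.
split.
- by exists [::]; rewrite ?big_nil.
- move=> _ _ [v vs ->] [w ws ->]; exists (v ++ w); last by rewrite big_cat.
  by move=> y; rewrite mem_cat => /orP[/vs|/ws].
- move=> _ [w ws ->]; elim: w ws => [|a w IHw] sws.
    by exists [::]; rewrite ?big_nil ?invg1.
  have [|v vs wv] := IHw; first by move=> y yw; apply: sws; rewrite inE yw orbT.
  have a_s : a \in s by apply: sws; rewrite mem_head.
  exists (v ++ nseq m.-1 a).
    by move=> y; rewrite mem_cat => /orP[/vs//|/nseqP[-> _]].
  rewrite big_cons invgM wv big_cat /=; congr (_ * _).
  by rewrite big_nseq iter_mulg_1; apply: mulg1_eq; rewrite -expgS prednK ?sm.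
Qed.

Lemma dietzmann (A : set G) : finite_set A ->
    (forall x, A x -> exists2 m, (0 < m)%N & x ^+ m = 1) ->
    (forall x g, A x -> A g -> A (x ^ g)) ->
  finite_set (generated A).
Proof.
move=> /finite_seqP[s ->] tor_s sJ.
have [m m_gt0 sm] := common_exponent tor_s.
apply: (@sub_finite_set _ _ [set` products s (size s * m)]) => // x.
move=> /(generated_word m_gt0 sm)[w ws ->].
have [v [vs v_le <-]] := short_word m_gt0 sm sJ ws.
exact: mem_products.
Qed.

End Dietzmann.

Lemma torsion_concise (G : groupType) (phi : formula 1) :
  torsion_group G -> concise G phi.
Proof.
move=> torG fin; apply: dietzmann => // x g ? _; exact: definable_setJ.
Qed.

Lemma proj_expg (G : groupType) (N : normalSubgroup G) (x : G) n :
  (proj N x ^+ n)%g = proj N (x ^+ n)%g.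
Proof. by elim: n => [|n IHn]; rewrite ?proj1 // !expgS IHn projM. Qed.

(** An [n]th power in the quotient is the class of some [x ^+ n], which lies in the normal closure
    by construction. *)
Lemma burnside_torsion d n : 0 < n -> torsion_group (burnside_group d n).
Proof.
move=> n_gt0 u; exists n => //; have [x <-] := proj_surj u.
rewrite proj_expg -proj1; apply/esym/proj_eq; rewrite invg1 mul1g.
by apply: sub_gen_smallest; exists x.
Qed.

Theorem corollary2p4 :
  (forall (G : groupType) (phi : formula 1),
     torsion_group G -> concise G phi) /\
  (forall (d n : nat) (phi : formula 1),
     0 < d -> 0 < n -> concise (burnside_group d n) phi).
Proof.
split=> [G phi|d n phi _ n_gt0]; first exact: torsion_concise.
exact/torsion_concise/burnside_torsion.
Qed.
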